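(* Let $K$ be a field and let $c\le d$ be two positive integers, each divisible by $4$. For $0\le i\le c$ put $\mu_i=\left\lceil (c-i)\frac dc\right\rceil$. Let $$I=\langle y^{d},\,x^{c/4}y^{\mu_{c/4}},\,x^{3c/4}y^{\mu_{3c/4}},\,x^{c}\rangle+J\subset K[x,y],$$ where $$J=\langle x^{c/2+c/4-k}\,y^{\mu_{c/2}+k-1}\mid k=1,2,\ldots,c/4\rangle=\langle x^{c/2+c/4-1}y^{\mu_{c/2}},\,x^{c/2+c/4-2}y^{\mu_{c/2}+1},\ldots,x^{c/2}y^{\mu_{c/2}+c/4-1}\rangle.$$ Then $$\widetilde{I}=\langle y^{d},\,x^{c/4}y^{\mu_{c/4}},\,x^{c/2}y^{\mu_{c/2}},\,x^{3c/4}y^{\mu_{3c/4}},\,x^{c}\rangle.$$ In particular, $\mu(I)=c/4+4$ while $\mu(\widetilde I)=5$, where $\mu(\cdot)$ of an ideal denotes its minimal number of generators.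
   Context: For a regular ideal $I$ (one containing a nonzerodivisor) of a commutative Noetherian ring $R$, the Ratliff-Rush closure of $I$ is $\widetilde{I}=\bigcup_{l\ge 1}(I^{l+1}:I^{l})$, where $I^{l+1}:I^l=\{z\in R\mid zI^l\subseteq I^{l+1}\}$. *)

(* Defs.v *)
From HB Require Import structures.
From mathcomp Require Import all_boot all_order all_algebra.
From mathcomp Require Import boolp classical_sets.
From mathcomp Require Import mpoly.

Set Implicit Arguments.
Unset Strict Implicit.
Unset Printing Implicit Defensive.

Import Order.TTheory GRing.Theory Num.Theory.
Local Open Scope classical_set_scope.
Local Open Scope ring_scope.

Section Ideals.
Variable R : comNzRingType.
Implicit Types (A B I S : set R) (s : seq R).

(* The ideals of ring_quotient.v are boolean predicates; membership in the
   ideals below is not assumed decidable, hence [set R]. *)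
Record is_ideal I : Prop := IsIdeal {
  ideal0 : I 0;
  idealD : forall a b, I a -> I b -> I (a + b);
  idealMl : forall r a, I a -> I (r * a)
}.

Definition ideal_gen S : set R := smallest is_ideal S.

Definition ideal_span s : set R := ideal_gen [set` s].

Definition ideal_add A B : set R := [set a + b | a in A & b in B].

(* Generated by the products, since these need not be closed under sums. *)
Definition ideal_mul A B : set R := ideal_gen [set a * b | a in A & b in B].

Fixpoint ideal_exp I (n : nat) : set R :=
  if n is m.+1 then ideal_mul I (ideal_exp I m) else setT.

Definition ideal_colon A B : set R := [set z | forall b, B b -> A (z * b)].

(* Meaningful when [R] is Noetherian and [I] is a regular ideal. *)
Definition ratliff_rush I : set R :=
  \bigcup_(l in [set l | (1 <= l)%N])
    ideal_colon (ideal_exp I l.+1) (ideal_exp I l).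

(* A relation rather than a function, so that no junk value has to be assigned
   to ideals that are not finitely generated. *)
Definition min_num_gens I (n : nat) : Prop :=
  (exists2 s, size s = n & I = ideal_span s) /\
  (forall s, I = ideal_span s -> (n <= size s)%N).

End Ideals.

(* The absolute value only casts the ceiling, nonnegative for [i <= c], to nat;
   for such [i] the natural-number subtraction is not truncated either. *)
Definition mu_exp (c d i : nat) : nat :=
  `|Num.ceil ((c - i)%N%:R * (d%:R / c%:R) : rat)|%N.

(* Main.v *)
Require Import Defs.
From HB Require Import structures.
From mathcomp Require Import all_boot all_order all_algebra.
From mathcomp Require Import boolp classical_sets.
From mathcomp Require Import mpoly zify ring.

Set Implicit Arguments.
Unset Strict Implicit.
Unset Printing Implicit Defensive.

Import Order.TTheory GRing.Theory Num.Theory.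
Local Open Scope classical_set_scope.
Local Open Scope ring_scope.

(** Write [c = 4a], [d = 4b], [u = x^a] and [v = y^b]; then [a <= b] and the
    exponents are [mu_(ia) = (4 - i) b], so that the ideal claimed to be the
    Ratliff-Rush closure is [T = (u, v)^4] and [I] arises from [T] by
    replacing the generator [u^2 v^2] by the [a] multiples
    [u^2 v^2 x^(a-k) y^(k-1)].

    Lower bound: already [T I] is contained in [I^2].  The only generator
    of [T] that may lie outside [I] is [u^2 v^2], and its products with the
    generators of [I] are
      [u^2 v^2 * v^4   = (u v^3)^2],   [u^2 v^2 * u v^3 = v^4 * u^3 v],
      [u^2 v^2 * u^3 v = u v^3 * u^4], [u^2 v^2 * u^4   = (u^3 v)^2],
    while its product with a generator in [J] is a multiple of [v^4 * u^4]
    (lemma [power_mul_sparse]).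

    Upper bound: give [x^i y^j] the weight [i %/ a + j %/ b].  Weights are
    superadditive, so the polynomials supported in weight at least [k] form
    ideals [W_k] with [W_j W_k] inside [W_(j+k)], and in fact
    [W_k = (u, v)^k] (lemma [weight_ideal_monom]).  Multiplying a monomial by
    [v^k] raises its weight by exactly [k].  Hence if [z I^l] lies in
    [I^(l+1)], then [z v^(4l)] lies in [W_(4l+4)] and so [z] lies in
    [W_4 = T] (lemma [ratliff_rush_weight]).

    Generators: both ideals are generated by monomials that are pairwise
    incomparable for divisibility, and no ideal generated by [N] such
    monomials has fewer than [N] generators (lemma
    [monom_ideal_min_gens]). *)

(** * Generated ideals, colons and powers *)

Lemma set_mem_cat (T : eqType) (s t : seq T) :
  [set` s ++ t] = [set` s] `|` [set` t].
Proof.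
apply/seteqP; split=> p /=; rewrite mem_cat; first by move/orP.
by case=> ->; rewrite ?orbT.
Qed.

Section Ideals.
Variable R : comNzRingType.
Implicit Types (A B I S : set R) (s : seq R).

Lemma ideal_gen_ideal S : is_ideal (ideal_gen S).
Proof.
split=> [M [[M0 _ _] _]|p q Sp Sq M MS|r p Sp M MS] //.
- by case: (MS) => -[_ MD _] _; apply: MD; [apply: Sp | apply: Sq].
- by case: (MS) => -[_ _ MM] _; apply: MM; apply: Sp.
Qed.

Lemma ideal_gen_sub S I : is_ideal I -> S `<=` I -> ideal_gen S `<=` I.
Proof. by move=> idI SI p; apply. Qed.

Lemma sub_ideal_gen S : S `<=` ideal_gen S.
Proof. exact: sub_gen_smallest. Qed.

Lemma ideal_sum I (J : Type) (r : seq J) (P : pred J) (F : J -> R) :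
  is_ideal I -> (forall j, P j -> I (F j)) -> I (\sum_(j <- r | P j) F j).
Proof. by move=> idI IF; apply: big_ind; [exact: ideal0 | exact: idealD |]. Qed.

Lemma ideal_add_gen A B :
  ideal_add (ideal_gen A) (ideal_gen B) = ideal_gen (A `|` B).
Proof.
apply/seteqP; split=> [_ [p Ap [q Bq <-]]|].
  apply: (idealD (ideal_gen_ideal _)).
  - apply: ideal_gen_sub Ap; first exact: ideal_gen_ideal.
    by move=> z Az; apply: sub_ideal_gen; left.
  - apply: ideal_gen_sub Bq; first exact: ideal_gen_ideal.
    by move=> z Bz; apply: sub_ideal_gen; right.
apply: ideal_gen_sub => [|z [Az|Bz]].
- have [A0 AD AM] := ideal_gen_ideal A; have [B0 BD BM] := ideal_gen_ideal B.
  split=> [|_ _ [p Ap [q Bq <-]] [p' Ap' [q' Bq' <-]]|r _ [p Ap [q Bq <-]]].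
  + by exists 0 => //; exists 0; rewrite ?addr0.
  + exists (p + p'); first exact: AD.
    by exists (q + q'); [exact: BD | rewrite addrACA].
  + exists (r * p); first exact: AM.
    by exists (r * q); [exact: BM | rewrite mulrDr].
- exists z; first exact: sub_ideal_gen.
  by exists 0; [exact: ideal0 (ideal_gen_ideal _) | rewrite addr0].
- exists 0; first exact: ideal0 (ideal_gen_ideal _).
  by exists z; [exact: sub_ideal_gen | rewrite add0r].
Qed.

Lemma ideal_span_coeffs s p :
  ideal_span s p -> exists r : 'I_(size s) -> R, p = \sum_j r j * s`_j.
Proof.
move: p; apply: ideal_gen_sub.
  split=> [|_ _ [r ->] [r' ->]|z _ [r ->]].
  - by exists (fun=> 0); rewrite big1 // => j _; rewrite mul0r.
  - exists (fun j => r j + r' j); rewrite -big_split.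
    by apply: eq_bigr => j _; rewrite mulrDl.
  - exists (fun j => z * r j); rewrite mulr_sumr.
    by apply: eq_bigr => j _; rewrite mulrA.
move=> p /= sp; have lt_ps : (index p s < size s)%N by rewrite index_mem.
exists (fun j => (j == Ordinal lt_ps)%:R); rewrite (bigD1 (Ordinal lt_ps)) //=.
rewrite eqxx mul1r nth_index // big1 ?addr0 // => j /negbTE ->.
by rewrite mul0r.
Qed.

Lemma ideal_colon_ideal A B : is_ideal A -> is_ideal (ideal_colon A B).
Proof.
move=> [A0 AD AM]; split=> [b _|p q Ap Aq b Bb|r p Ap b Bb].
- by rewrite mul0r.
- by rewrite mulrDl; apply: AD; [apply: Ap | apply: Aq].
- by rewrite -mulrA; apply/AM/Ap.
Qed.

(** Testing membership in a colon ideal on generators of the divisor is what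
    makes [T] inside [I^2 : I] a finite verification. *)
Lemma ideal_colon_gen A S :
  is_ideal A -> ideal_colon A (ideal_gen S) = ideal_colon A S.
Proof.
move=> idA; apply/seteqP; split=> z zS p Sp.
  by apply: zS; apply: sub_ideal_gen.
apply: (@ideal_gen_sub S [set q | A (z * q)] _ _ p Sp) => //.
case: idA => A0 AD AM; split=> /= [|q q' Aq Aq'|r q Aq].
- by rewrite mulr0.
- by rewrite mulrDr; apply: AD.
- by rewrite mulrCA; apply: AM.
Qed.

Lemma ideal_exp_ideal I n : is_ideal (ideal_exp I n).
Proof. by case: n => [|n]; [split | exact: ideal_gen_ideal]. Qed.

Lemma ideal_expS I n p q :
  I p -> ideal_exp I n q -> ideal_exp I n.+1 (p * q).
Proof. by move=> Ip Iq; apply: sub_ideal_gen; exists p => //; exists q. Qed.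

Lemma ideal_exp1 I : is_ideal I -> ideal_exp I 1 = I.
Proof.
move=> idI; apply/seteqP; split=> [|p Ip].
  apply: ideal_gen_sub => // _ [p Ip [q _ <-]].
  by rewrite mulrC; apply: (idealMl idI).
by rewrite -[p]mulr1; apply: ideal_expS.
Qed.

Lemma ideal_expX I n p : I p -> ideal_exp I n (p ^+ n).
Proof. by move=> Ip; elim: n => // n IHn; rewrite exprS; apply: ideal_expS. Qed.

End Ideals.

(** * Monomial ideals and their minimal generators *)

Section MonomialIdeals.
Variables (R : comNzRingType) (n : nat).
Implicit Types (D : pred 'X_{1..n}) (E : seq 'X_{1..n}) (e m : 'X_{1..n}).
Implicit Types (p q : {mpoly R[n]}).

Definition supported_in D : set {mpoly R[n]} :=
  [set p | forall m, m \in msupp p -> D m].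

Definition monom_ideal E : set {mpoly R[n]} :=
  ideal_span [seq 'X_[e] | e <- E].

Lemma supported_in_ideal D :
  (forall m m', D m -> D (m + m')%MM) -> is_ideal (supported_in D).
Proof.
move=> upD; split=> [m|p q Dp Dq m|r p Dp m]; first by rewrite msupp0.
- by move/msuppD_le; rewrite mem_cat => /orP[/Dp|/Dq].
- move/msuppM_le => /allpairsP[[m1 m2] /= [_ /Dp Dm2 ->]].
  by rewrite addmC; apply: upD.
Qed.

Lemma monom_ideal_ideal E : is_ideal (monom_ideal E).
Proof. exact: ideal_gen_ideal. Qed.

Lemma monom_ideal_mem E m e :
  e \in E -> (e <= m)%MM -> monom_ideal E 'X_[m].
Proof.
move=> Ee /submK <-; rewrite mpolyXD; apply: (idealMl (monom_ideal_ideal E)).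
by apply: sub_ideal_gen => /=; apply: map_f.
Qed.

(** This turns inclusions between monomial ideals, and between such ideals and
    the weight ideals below, into statements about single exponents. *)
Lemma monom_idealP E :
  monom_ideal E = supported_in (fun m => has (fun e => e <= m)%MM E).
Proof.
apply/seteqP; split=> [|p Ep].
  apply: ideal_gen_sub => [|_ /mapP[e Ee ->] m].
    apply: supported_in_ideal => m m' /hasP[e Ee le_em].
    apply/hasP; exists e => //.
    exact: lepm_trans le_em (lem_addr _ _).
  by rewrite msuppX inE => /eqP->; apply/hasP; exists e => //; apply: lepm_refl.
have idE := monom_ideal_ideal E.
rewrite [p]mpolyE big_seq; apply: ideal_sum => // m /Ep /hasP[e Ee le_em].
rewrite -mul_mpolyC; apply: (idealMl idE); exact: monom_ideal_mem Ee le_em.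
Qed.

Lemma monom_ideal_sub E F :
    (forall e, e \in E -> exists2 f, f \in F & (f <= e)%MM) ->
  monom_ideal E `<=` monom_ideal F.
Proof.
move=> EF; apply: ideal_gen_sub; first exact: monom_ideal_ideal.
by move=> _ /mapP[e /EF[f Ff le_fe] ->]; apply: monom_ideal_mem Ff le_fe.
Qed.

Definition antichain E :=
  forall e f, e \in E -> f \in E -> (e <= f)%MM -> e = f.

(** Every monomial of [p] is divisible by some generator; one that divides the
    minimal generator [e] has to be [e] itself, so the constant term of [r] is
    the only part of [r] that reaches the coefficient at [e]. *)
Lemma mcoeffM_minimal E r p e :
  antichain E -> e \in E -> monom_ideal E p -> (r * p)@_e = r@_0%MM * p@_e.
Proof.
move=> acE Ee; rewrite monom_idealP => Ep.
pose k0 : 'X_{1..n < (mdeg e).+1, (mdeg e).+1} :=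
  (bm0, BMultinom (ltnSn (mdeg e))).
rewrite mcoeffM (bigD1 k0) /=; last by rewrite add0m.
rewrite big1 ?addr0 // => -[[k1 lt1] [k2 lt2]] /= /andP[/eqP eq_e ne_k].
have [->|] := eqVneq p@_k2 0; first by rewrite mulr0.
rewrite -mcoeff_msupp => /Ep /hasP[f Ef le_fk2].
have le_k2e : (k2 <= e)%MM by rewrite eq_e lem_addl.
have eq_fe := acE _ _ Ef Ee (lepm_trans le_fk2 le_k2e).
have eq_k2 : k2 = e.
  apply/mnmP => i; apply/eqP.
  by rewrite eqn_leq (mnm_lepP le_k2e) -eq_fe (mnm_lepP le_fk2).
suff eq_k1 : k1 = 0%MM.
  case/negP: ne_k; rewrite /k0 -pair_eqE /= -!val_eqE /=.
  by rewrite eq_k1 eq_k2 !eqxx.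
by apply: (@addIm _ k2); rewrite add0m -eq_e.
Qed.

(** Express the monomials of [E] through the generators [s] by polynomial
    coefficients [r].  By [mcoeffM_minimal], comparing coefficients at the
    exponents in [E] gives [B *m A = 1], where [B] holds the constant terms of
    [r] and [A] the coefficients of [s]; so [A] has at least as many rows as
    columns.  This is the count of [dim I / m I], done with matrices. *)
Lemma monom_ideal_min_gens E s :
  uniq E -> antichain E -> monom_ideal E = ideal_span s -> (size E <= size s)%N.
Proof.
move=> uE acE eqEs.
have /choice[r rE] (i : 'I_(size E)) : exists r : 'I_(size s) -> {mpoly R[n]},
    'X_[tnth (in_tuple E) i] = \sum_j r j * s`_j.
  apply: ideal_span_coeffs; rewrite -eqEs.
  exact: monom_ideal_mem (mem_tnth i (in_tuple E)) (lepm_refl _).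
pose B := \matrix_(i < size E, j < size s) (r i j)@_0%MM.
pose A := \matrix_(j < size s, i < size E) (s`_j)@_(tnth (in_tuple E) i).
apply: (@mulmx1_min _ _ _ B A); apply/matrixP => i k; rewrite !mxE.
have -> : (i == k) = (tnth (in_tuple E) i == tnth (in_tuple E) k).
  by apply/esym/inj_eq/tuple_uniqP.
rewrite -mcoeffX rE raddf_sum /=; apply: eq_bigr => j _; rewrite !mxE.
rewrite (@mcoeffM_minimal E) ?mem_tnth //.
by rewrite eqEs; apply: sub_ideal_gen => /=; apply: mem_nth.
Qed.

Lemma min_num_gens_monom E :
  uniq E -> antichain E -> min_num_gens (monom_ideal E) (size E).
Proof.
move=> uE acE; split; last by move=> s; apply: monom_ideal_min_gens.
by exists [seq 'X_[e] | e <- E]; rewrite ?size_map.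
Qed.

Lemma monom_ideal_exp2 E f g m : f \in E -> g \in E -> (f + g <= m)%MM ->
  ideal_exp (monom_ideal E) 2 'X_[m].
Proof.
move=> Ef Eg /submK <-; rewrite mpolyXD.
apply: (idealMl (ideal_exp_ideal _ _)); rewrite mpolyXD; apply: ideal_expS.
  exact: monom_ideal_mem Ef (lepm_refl _).
rewrite ideal_exp1; last exact: monom_ideal_ideal.
exact: monom_ideal_mem Eg (lepm_refl _).
Qed.

(** The products of generators are tested in [I^2] because the exponent [l = 1]
    in the definition of the closure suffices here. *)
Lemma sub_ratliff_rush_monom E F :
    (forall e f, e \in F -> f \in E ->
       ideal_exp (monom_ideal E) 2 'X_[e + f]) ->
  monom_ideal F `<=` ratliff_rush (monom_ideal E).
Proof.
move=> FE p Fp; exists 1 => //; move: p Fp; apply: ideal_gen_sub.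
  exact/ideal_colon_ideal/ideal_exp_ideal.
rewrite ideal_exp1; last exact: monom_ideal_ideal.
rewrite ideal_colon_gen; last exact: ideal_exp_ideal.
move=> _ /mapP[e Fe ->] _ /mapP[f Ef ->].
by rewrite -mpolyXD; apply: FE.
Qed.

End MonomialIdeals.

(** * The weight filtration of the polynomials in two variables *)

Section Weight.
Variables (R : comNzRingType) (a b : nat).
Hypotheses (a_gt0 : (0 < a)%N) (b_gt0 : (0 < b)%N).

Definition bimon (e : nat * nat) : 'X_{1..2} :=
  (U_(0%R) *+ e.1 + U_(1%R) *+ e.2)%MM.

Lemma bimonE0 e : bimon e 0 = e.1.
Proof. by rewrite mnmDE !mulmnE !mnm1E /= mul1n mul0n addn0. Qed.

Lemma bimonE1 e : bimon e 1 = e.2.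
Proof. by rewrite mnmDE !mulmnE !mnm1E /= mul1n mul0n. Qed.

Lemma mnm2_leP (m m' : 'X_{1..2}) :
  reflect ((m 0%R <= m' 0%R)%N /\ (m 1%R <= m' 1%R)%N) (m <= m')%MM.
Proof.
apply: (iffP mnm_lepP) => [le_mm'|[le0 le1] i]; first by split.
have [->|->] // : i = 0 \/ i = 1.
by case: i => [[|[|i]] lt_i2] //; [left | right]; apply: val_inj.
Qed.

Lemma bimon_inj : injective bimon.
Proof.
move=> e f eq_ef; apply: injective_projections.
  by rewrite -!bimonE0 eq_ef.
by rewrite -!bimonE1 eq_ef.
Qed.

Lemma mpolyX_bimon e : 'X_[bimon e] = 'X_0 ^+ e.1 * 'X_1 ^+ e.2 :> {mpoly R[2]}.
Proof. by rewrite mpolyXD !mpolyXn. Qed.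

Definition weight (m : 'X_{1..2}) : nat := (m 0%R %/ a + m 1%R %/ b)%N.

Lemma leq_weightD m m' : (weight m + weight m' <= weight (m + m')%MM)%N.
Proof.
by rewrite /weight !mnmDE addnACA leq_add // divnD // leq_addr.
Qed.

(** The equality, as opposed to [leq_weightD], is what allows cancelling a
    power of [y^b] in [ratliff_rush_weight]. *)
Lemma weight_shift (m : 'X_{1..2}) k :
  weight (m + bimon (0, k * b)%N)%MM = (weight m + k)%N.
Proof.
by rewrite /weight !(mnmDE _ m) bimonE0 bimonE1 addn0 divnDMl // addnA.
Qed.

Definition weight_ideal k : set {mpoly R[2]} :=
  supported_in (fun m => k <= weight m)%N.

Lemma weight_ideal_ideal k : is_ideal (weight_ideal k).
Proof.
apply: supported_in_ideal => m m' le_km.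
exact: leq_trans le_km (leq_trans (leq_addr _ _) (leq_weightD _ _)).
Qed.

Lemma weight_idealM j k p q :
  weight_ideal j p -> weight_ideal k q -> weight_ideal (j + k) (p * q).
Proof.
move=> Wp Wq m /msuppM_le /allpairsP[[m1 m2] /= [/Wp Wm1 /Wq Wm2 ->]].
exact: leq_trans (leq_add Wm1 Wm2) (leq_weightD _ _).
Qed.

Lemma ideal_exp_weight I j l :
  I `<=` weight_ideal j -> ideal_exp I l `<=` weight_ideal (l * j).
Proof.
move=> IW; elim: l => [|l IHl]; first by move=> p _ m.
apply: ideal_gen_sub; first exact: weight_ideal_ideal.
by move=> _ [p Ip [q Iq <-]]; apply: weight_idealM; [apply: IW | apply: IHl].
Qed.

(** If [z I^l] lies in [I^(l+1)], then [z y^(lkb)] has weights at least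
    [(l+1)k]; since [y^(lkb)] adds exactly [lk] to every weight, those of [z]
    are at least [k]. *)
Lemma ratliff_rush_weight I k :
  I `<=` weight_ideal k -> I 'X_[bimon (0, k * b)%N] ->
  ratliff_rush I `<=` weight_ideal k.
Proof.
move=> IW Iv z [l _ zI] m; rewrite mcoeff_msupp => zm.
have /(ideal_exp_weight IW) Wz := zI _ (ideal_expX l Iv).
rewrite -(leq_add2r (l * k)) -weight_shift -mulSn.
apply: Wz; rewrite mcoeff_msupp.
have -> : 'X_[bimon (0, k * b)%N] ^+ l
          = 'X_[bimon (0, l * k * b)%N] :> {mpoly R[2]}.
  by rewrite !mpolyX_bimon /= !expr0 !mul1r -exprM; congr (_ ^+ _); lia.
by rewrite addmC mcoeffMX.
Qed.

(** The exponents of the monomials [u^i v^(k-i)] generating [(u, v)^k]. *)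
Definition power_exponents k := [seq (i * a, (k - i) * b)%N | i <- iota 0 k.+1].

(** A monomial of weight at least [k] is divisible by [u^i v^(k-i)], where [i]
    is the power of [u] dividing it, capped at [k]. *)
Lemma weight_ideal_monom k :
  weight_ideal k = @monom_ideal R 2 [seq bimon e | e <- power_exponents k].
Proof.
rewrite monom_idealP; apply/seteqP; split=> p Wp m /Wp.
  rewrite /weight => le_k; apply/hasP.
  pose i := minn (m 0%R %/ a) k.
  exists (bimon (i * a, (k - i) * b)%N).
    by apply/map_f/mapP; exists i => //; rewrite mem_iota; lia.
  apply/mnm2_leP; rewrite bimonE0 bimonE1 /=; split.
    by apply: leq_trans (leq_trunc_div _ a); rewrite leq_mul2r geq_minl orbT.
  apply: leq_trans (leq_trunc_div _ b); rewrite leq_mul2r.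
  apply/orP; right; rewrite /i.
  by move: (_ %/ a)%N (_ %/ b)%N le_k => p' q'; lia.
move=> /hasP[_ /mapP[_ /mapP[i ik ->] ->] /mnm2_leP].
rewrite bimonE0 bimonE1 /= -!leq_divRL // => -[le0 le1].
rewrite mem_iota in ik; rewrite /weight.
by move: (_ %/ a)%N (_ %/ b)%N le0 le1 => p' q'; lia.
Qed.

Lemma power_exponents_antichain k :
  antichain [seq bimon e | e <- power_exponents k].
Proof.
move=> _ _ /mapP[_ /mapP[i ik ->] ->] /mapP[_ /mapP[j jk ->] ->] /mnm2_leP.
rewrite !bimonE0 !bimonE1 /= !leq_pmul2r // => -[le0 le1].
by move: ik jk; rewrite !mem_iota => ik jk; have -> : i = j by lia.
Qed.

Lemma power_exponents_uniq k : uniq [seq bimon e | e <- power_exponents k].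
Proof.
rewrite map_inj_uniq; last exact: bimon_inj.
rewrite map_inj_uniq ?iota_uniq // => i j [/eqP].
by rewrite eqn_pmul2r // => /eqP.
Qed.

End Weight.

(** * The ideal with a staircase in place of the middle generator *)

Section Exponents.
Variables (a b : nat).
Hypotheses (a_gt0 : (0 < a)%N) (le_ab : (a <= b)%N).

Definition outer_exponents :=
  [:: (0, 4 * b); (a, 3 * b); (3 * a, b); (4 * a, 0)]%N.

Definition staircase := [seq (2 * a + a - k, 2 * b + k - 1)%N | k <- iota 1 a].

Definition sparse_exponents := outer_exponents ++ staircase.

(** The staircase lies on an antidiagonal; in this form membership is plain
    linear arithmetic. *)
Lemma mem_staircase e :
  (e \in staircase) =
  ((e.1 + e.2 + 1 == 3 * a + 2 * b) && (2 * b <= e.2 < 2 * b + a))%N.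
Proof.
case: e => i j; apply/mapP/idP => /= [[k + [-> ->]]|/andP[/eqP eq_ij lt_j]].
  by rewrite mem_iota; lia.
by exists (j.+1 - 2 * b)%N; rewrite ?mem_iota; [lia | congr (_, _); lia].
Qed.

Lemma mem_sparse e : (e \in sparse_exponents) =
  [|| e == (0, 4 * b)%N, e == (a, 3 * b)%N, e == (3 * a, b)%N,
      e == (4 * a, 0)%N | e \in staircase].
Proof. by rewrite mem_cat !inE -!orbA. Qed.

Lemma size_sparse : size sparse_exponents = (a + 4)%N.
Proof. by rewrite size_cat size_map size_iota addnC. Qed.

Lemma sparse_uniq : uniq [seq bimon e | e <- sparse_exponents].
Proof.
rewrite map_inj_uniq; last exact: bimon_inj.
rewrite cat_uniq; apply/and3P; split.
- by rewrite /= !inE !xpair_eqE; lia.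
- apply/hasPn => -[i j]; rewrite mem_staircase !inE !xpair_eqE /=; lia.
- rewrite map_inj_in_uniq ?iota_uniq // => k l + + [_].
  by rewrite !mem_iota; lia.
Qed.

(** The bound [a <= b] enters here: it keeps the largest [y]-exponent of the
    staircase, [2 b + a - 1], below the [y]-exponent [3 b] of [u v^3]. *)
Lemma sparse_antichain : antichain [seq bimon e | e <- sparse_exponents].
Proof.
move=> _ _ /mapP[[i j] + ->] /mapP[[k l] + ->] /mnm2_leP.
rewrite !bimonE0 !bimonE1 !mem_sparse !mem_staircase !xpair_eqE /=.
move=> ij kl le_ij_kl; have -> : i = k by lia.
by have -> : j = l by lia.
Qed.

Lemma sparse_sub_power e : e \in sparse_exponents ->
  exists2 f, f \in power_exponents a b 4 & (f.1 <= e.1)%N && (f.2 <= e.2)%N.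
Proof.
case: e => i j; rewrite mem_sparse mem_staircase.
have memP n : (n <= 4)%N -> (n * a, (4 - n) * b)%N \in power_exponents a b 4.
  by move=> le_n4; apply/mapP; exists n; rewrite ?mem_iota.
case/or4P => [/eqP[-> ->]|/eqP[-> ->]|/eqP[-> ->]|/orP[/eqP[-> ->]|st]].
- by exists (0 * a, 4 * b)%N; [exact: (memP 0%N) | rewrite /=; lia].
- by exists (1 * a, 3 * b)%N; [exact: (memP 1%N) | rewrite /=; lia].
- by exists (3 * a, 1 * b)%N; [exact: (memP 3%N) | rewrite /=; lia].
- by exists (4 * a, 0 * b)%N; [exact: (memP 4%N) | rewrite /=; lia].
- by exists (2 * a, 2 * b)%N; [exact: (memP 2%N) | move: st; rewrite /=; lia].
Qed.

(** The products [u^2 v^2 * v^4 = (u v^3)^2] and so on displayed above, read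
    off on exponents: they put [T I] inside [I^2]. *)
Lemma power_mul_sparse e f :
    e \in power_exponents a b 4 -> f \in sparse_exponents ->
  exists g h, [/\ g \in sparse_exponents, h \in sparse_exponents,
    (g.1 + h.1 <= e.1 + f.1)%N & (g.2 + h.2 <= e.2 + f.2)%N].
Proof.
have s0 : (0, 4 * b)%N \in sparse_exponents by rewrite mem_sparse eqxx.
have s1 : (a, 3 * b)%N \in sparse_exponents by rewrite mem_sparse eqxx orbT.
have s3 : (3 * a, b)%N \in sparse_exponents by rewrite mem_sparse eqxx !orbT.
have s4 : (4 * a, 0)%N \in sparse_exponents by rewrite mem_sparse eqxx !orbT.
have -> : power_exponents a b 4 =
    [:: (0, 4 * b); (a, 3 * b); (2 * a, 2 * b); (3 * a, b); (4 * a, 0)]%N.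
  by rewrite /power_exponents /= mul0n !mul1n.
move=> eT fs.
have [es|] := boolP (e \in sparse_exponents); first by exists e, f.
have [-> _|ne2] := eqVneq e (2 * a, 2 * b)%N; last first.
  rewrite mem_sparse; move: eT; rewrite !inE (negbTE ne2) /=.
  by case/or4P => ->; rewrite ?orbT.
move: fs; case: f => i j; rewrite mem_sparse mem_staircase.
case/or4P => [/eqP[-> ->]|/eqP[-> ->]|/eqP[-> ->]|/orP[/eqP[-> ->]|st]].
- by exists (a, 3 * b)%N, (a, 3 * b)%N; split=> //=; lia.
- by exists (0, 4 * b)%N, (3 * a, b)%N; split=> //=; lia.
- by exists (a, 3 * b)%N, (4 * a, 0)%N; split=> //=; lia.
- by exists (3 * a, b)%N, (3 * a, b)%N; split=> //=; lia.
- by exists (0, 4 * b)%N, (4 * a, 0)%N; split=> //; move: st => /=; lia.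
Qed.

Variable R : comNzRingType.

Lemma ratliff_rush_sparse :
  ratliff_rush (@monom_ideal R 2 [seq bimon e | e <- sparse_exponents]) =
  @monom_ideal R 2 [seq bimon e | e <- power_exponents a b 4].
Proof.
have b_gt0 := leq_trans a_gt0 le_ab.
apply/seteqP; split.
  rewrite -weight_ideal_monom //; apply: ratliff_rush_weight => //.
    rewrite (weight_ideal_monom _ a_gt0 b_gt0).
    apply: monom_ideal_sub => _ /mapP[e Ee ->].
    have [f Ff /andP[le0 le1]] := sparse_sub_power Ee.
    exists (bimon f); first exact: map_f.
    by apply/mnm2_leP; rewrite !bimonE0 !bimonE1.
  apply: (@monom_ideal_mem _ _ _ _ (bimon (0, 4 * b)%N)); last exact: lepm_refl.
  by apply: map_f; rewrite mem_sparse eqxx.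
apply: sub_ratliff_rush_monom => _ _ /mapP[e Fe ->] /mapP[f Ef ->].
have [g [h [Eg Eh le0 le1]]] := power_mul_sparse Fe Ef.
apply: (@monom_ideal_exp2 _ _ _ (bimon g) (bimon h)); try exact: map_f.
apply/mnm2_leP; rewrite !(mnmDE _ (bimon g)) !(mnmDE _ (bimon e)).
by rewrite !bimonE0 !bimonE1.
Qed.

End Exponents.

(** * The closure and the numbers of generators *)

(** Because [4 b / 4 a = b / a], the ceiling is taken of an integer. *)
Lemma mu_expE (a b i : nat) :
  (0 < a)%N -> mu_exp (4 * a) (4 * b) (i * a) = ((4 - i) * b)%N.
Proof.
move=> a_gt0; rewrite /mu_exp -mulnBl.
have -> : (((4 - i) * a)%N%:R * ((4 * b)%N%:R / (4 * a)%N%:R) : rat)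
          = ((4 - i) * b)%N%:R.
  have a_neq0 : a%:R != 0 :> rat by rewrite pnatr_eq0 -lt0n.
  by rewrite !natrM; field.
by rewrite pmulrn intrKceil absz_nat.
Qed.

Theorem corollary18 (K : fieldType) (c d : nat)
    (c_gt0 : (0 < c)%N) (d_gt0 : (0 < d)%N) (le_cd : (c <= d)%N)
    (dvd4c : (4 %| c)%N) (dvd4d : (4 %| d)%N) :
  let x : {mpoly K[2]} := 'X_0 in
  let y : {mpoly K[2]} := 'X_1 in
  let mu := mu_exp c d in
  let J := ideal_gen
    [set x ^+ (c %/ 2 + c %/ 4 - k)%N * y ^+ (mu (c %/ 2)%N + k - 1)%N
       | k in [set k : nat | (1 <= k <= c %/ 4)%N]] in
  let I := ideal_add
    (ideal_span [:: y ^+ d;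
                    x ^+ (c %/ 4) * y ^+ mu (c %/ 4)%N;
                    x ^+ (3 * c %/ 4) * y ^+ mu (3 * c %/ 4)%N;
                    x ^+ c]) J in
  [/\ ratliff_rush I =
        ideal_span [:: y ^+ d;
                       x ^+ (c %/ 4) * y ^+ mu (c %/ 4)%N;
                       x ^+ (c %/ 2) * y ^+ mu (c %/ 2)%N;
                       x ^+ (3 * c %/ 4) * y ^+ mu (3 * c %/ 4)%N;
                       x ^+ c],
      min_num_gens I (c %/ 4 + 4) &
      min_num_gens (ratliff_rush I) 5].
Proof.
move=> x y mu J I.
pose a := (c %/ 4)%N; pose b := (d %/ 4)%N.
have cE : c = (4 * a)%N by lia.
have dE : d = (4 * b)%N by lia.
have a_gt0 : (0 < a)%N by lia.
have le_ab : (a <= b)%N by lia.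
have b_gt0 := leq_trans a_gt0 le_ab.
have mu1 : mu (c %/ 4)%N = (3 * b)%N.
  by rewrite -[(c %/ 4)%N]mul1n /mu {1}cE dE mu_expE.
have c2 : (c %/ 2 = 2 * a)%N by lia.
have c3 : (3 * c %/ 4 = 3 * a)%N by lia.
have mu2 : mu (c %/ 2)%N = (2 * b)%N by rewrite c2 /mu cE dE mu_expE.
have mu3 : mu (3 * c %/ 4)%N = b by rewrite c3 /mu cE dE mu_expE // mul1n.
have TE : ideal_span [:: y ^+ d; x ^+ (c %/ 4) * y ^+ mu (c %/ 4)%N;
      x ^+ (c %/ 2) * y ^+ mu (c %/ 2)%N;
      x ^+ (3 * c %/ 4) * y ^+ mu (3 * c %/ 4)%N; x ^+ c]
    = @monom_ideal K 2 [seq bimon e | e <- power_exponents a b 4].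
  rewrite mu1 mu2 mu3 c2 c3 -/a [in y ^+ d]dE [in x ^+ c]cE /monom_ideal /=.
  by rewrite !mpolyX_bimon /= mul0n !mul1n !expr0 mul1r mulr1.
have IE : I = @monom_ideal K 2 [seq bimon e | e <- sparse_exponents a b].
  have JE : [set x ^+ (2 * a + a - k)%N * y ^+ (2 * b + k - 1)%N
               | k in [set k : nat | (1 <= k <= a)%N]]
      = [set` [seq 'X_[m] | m <- [seq bimon e | e <- staircase a b]]].
    apply/seteqP.
    split=> [_ [k /= ka <-]|_ /mapP[_ /mapP[_ /mapP[k ka ->] ->] ->]].
      rewrite -(mpolyX_bimon _ (_, _)); do 2!apply: map_f; apply: map_f.
      by rewrite mem_iota; lia.
    by exists k; [move: ka; rewrite mem_iota /=; lia | rewrite mpolyX_bimon].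
  rewrite /I /J ideal_add_gen; congr ideal_gen.
  rewrite mu1 mu2 mu3 c2 c3 -/a [in y ^+ d]dE [in x ^+ c]cE JE.
  rewrite /sparse_exponents !map_cat.
  have -> : [:: y ^+ (4 * b); x ^+ a * y ^+ (3 * b); x ^+ (3 * a) * y ^+ b;
                x ^+ (4 * a)]
      = [seq 'X_[m] | m <- [seq bimon e | e <- outer_exponents a b]].
    by rewrite /= !mpolyX_bimon /= !expr0 mul1r mulr1.
  by rewrite set_mem_cat.
rewrite IE (ratliff_rush_sparse a_gt0 le_ab) TE; split.
- reflexivity.
- have := min_num_gens_monom K (sparse_uniq a_gt0 le_ab)
            (sparse_antichain a_gt0 le_ab).
  by rewrite size_map size_sparse.
- have := min_num_gens_monom K (power_exponents_uniq b a_gt0 4)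
            (power_exponents_antichain a_gt0 b_gt0 (k := 4)).
  by rewrite 2!size_map size_iota.
Qed.
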